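(* Let $(X,d,\mu)$ be a metric measure space satisfying a Poincaré inequality of type $(1,p)$ for some $1\le p<\infty$. If $x\in X$ satisfies $\liminf_{r\to0}\mu(B_r(x))/r^p=0$, then $x$ is not a local cut point.
   Context: Here $(X,d)$ is a complete, locally compact length space with a Borel measure $\mu$ such that $0<\mu(B_r(x))<\infty$ for all $x\in X$, $0<r<\infty$ ($B_r(x)$ the open ball). Paths are assumed parametrized proportionally to arclength. For a function $u$ on $X$, a Borel function $g:X\to[0,\infty]$ is an upper gradient of $u$ if $|u(\gamma(l))-u(\gamma(0))|\le\int_0^l g(\gamma(t))\,dt$ for every path $\gamma:[0,l]\to X$. For $B\subset X$ write $u_B=\mu(B)^{-1}\int_B u\,d\mu$ and $\fint_B f\,d\mu=\mu(B)^{-1}\int_B f\,d\mu$. $(X,d,\mu)$ satisfies a Poincaré inequality of type $(1,p)$ if for every $R>0$ there is $C_P=C_P(p,R)>0$ such that $\fint_{B_r(x)}|u-u_{B_r(x)}|\,d\mu\le C_P\,r\big(\fint_{B_r(x)}g^p\,d\mu\big)^{1/p}$ for all $x\in X$, $0<r\le R$, all measurable functions $u$ and all upper gradients $g$ of $u$. A point $x\in X$ is a local cut point if $U\setminus\{x\}$ is disconnected for some connected neighborhood $U$ of $x$. *)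

(* Defs.v *)
From HB Require Import structures.
From mathcomp Require Import all_boot all_order all_algebra.
From mathcomp Require Import all_classical all_reals all_analysis.
From mathcomp Require Import measurable_realfun.
Set Implicit Arguments. Unset Strict Implicit. Unset Printing Implicit Defensive.
Import Order.TTheory GRing.Theory Num.Theory.
Import numFieldNormedType.Exports.
Local Open Scope classical_set_scope.
Local Open Scope ring_scope.

Section metric_defs.
Context {R : realType} {X : Type} (dist : X -> X -> R).

Definition is_metric : Prop :=
  (forall x y, 0 <= dist x y) /\
  (forall x y, dist x y = 0 <-> x = y) /\
  (forall x y, dist x y = dist y x) /\
  (forall x y z, dist x z <= dist x y + dist y z).

Definition oball (x : X) (r : R) : set X := [set y | dist x y < r].

Definition dopen (U : set X) : Prop :=
  forall y, U y -> exists2 r : R, 0 < r & oball y r `<=` U.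

Definition dcomplete : Prop :=
  forall u : nat -> X,
    (forall e : R, 0 < e -> exists N, forall m n, (N <= m)%N -> (N <= n)%N ->
        dist (u m) (u n) < e) ->
    exists l, forall e : R, 0 < e -> exists N, forall n, (N <= n)%N -> dist (u n) l < e.

Definition dcompact (K : set X) : Prop :=
  forall u : nat -> X, (forall n, K (u n)) ->
    exists (phi : nat -> nat) (l : X), (forall n, (phi n < phi n.+1)%N) /\ K l /\
      forall e : R, 0 < e -> exists N, forall n, (N <= n)%N -> dist (u (phi n)) l < e.

Definition dlocally_compact : Prop :=
  forall x, exists K, dcompact K /\ exists2 r : R, 0 < r & oball x r `<=` K.

Definition variation (gamma : R -> X) (a b : R) : \bar R :=
  ereal_sup [set v | exists (n : nat) (s : nat -> R),
     [/\ s 0%N = a, s n = b, (forall i, (i < n)%N -> s i <= s i.+1) &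
         v = (\sum_(i < n) dist (gamma (s i)) (gamma (s i.+1)))%:E]].

Definition dcontinuous_on (gamma : R -> X) (a b : R) : Prop :=
  forall t, a <= t <= b -> forall e : R, 0 < e -> exists2 delta : R, 0 < delta &
    forall s, a <= s <= b -> `|s - t| < delta -> dist (gamma t) (gamma s) < e.

Definition dlength_space : Prop :=
  forall x y, (dist x y)%:E =
    ereal_inf [set variation gamma 0 1 | gamma in
      [set gamma : R -> X | dcontinuous_on gamma 0 1 /\ gamma 0 = x /\ gamma 1 = y]].

Definition arclength_path (gamma : R -> X) (l : R) : Prop :=
  0 <= l /\ forall s t, 0 <= s -> s <= t -> t <= l ->
    variation gamma s t = (t - s)%:E.

Definition dconnected (A : set X) : Prop :=
  forall U V, dopen U -> dopen V -> A `<=` U `|` V ->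
    A `&` U !=set0 -> A `&` V !=set0 -> A `&` U `&` V !=set0.

Definition dneighborhood (x : X) (U : set X) : Prop :=
  exists2 r : R, 0 < r & oball x r `<=` U.

Definition local_cut_point (x : X) : Prop :=
  exists U, dneighborhood x U /\ dconnected U /\ ~ dconnected (U `\ x).

End metric_defs.

Section measure_defs.
Local Open Scope ereal_scope.
Context {R : realType} {d : measure_display} {X : measurableType d}
  (dist : X -> X -> R) (mu : {measure set X -> \bar R}).

Definition upper_gradient (u : X -> R) (g : X -> \bar R) : Prop :=
  forall (gamma : R -> X) (l : R), arclength_path dist gamma l ->
    (`|u (gamma l) - u (gamma 0%R)|)%:E <=
      \int[lebesgue_measure]_(t in `[0%R, l]) g (gamma t).

Definition poincare_1p (p : R) : Prop :=
  forall Rad : R, (0 < Rad)%R -> exists2 C : R, (0 < C)%R &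
    forall (x : X) (r : R), (0 < r)%R -> (r <= Rad)%R ->
    forall (u : X -> R) (g : X -> \bar R),
      measurable_fun setT u ->
      mu.-integrable (oball dist x r) (EFin \o u) ->
      measurable_fun setT g -> (forall y, 0 <= g y) ->
      upper_gradient u g ->
      let B := oball dist x r in
      let m := fine (mu B) in
      let uB := (m^-1 * fine (\int[mu]_(y in B) (u y)%:E))%R in
      (m^-1)%:E * \int[mu]_(y in B) (`|u y - uB|)%:E
        <= (C * r)%:E * ((m^-1)%:E * \int[mu]_(y in B) (g y `^ p)) `^ (p^-1).

End measure_defs.

(* Main.v *)
Require Import Defs.
From HB Require Import structures.
From mathcomp Require Import all_boot all_order all_algebra.
From mathcomp Require Import all_classical all_reals all_analysis.
From mathcomp Require Import measurable_realfun lra.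
Import Order.TTheory GRing.Theory Num.Theory.
Import numFieldNormedType.Exports.
Local Open Scope classical_set_scope.
Local Open Scope ring_scope.

(** If x is a local cut point, a small punctured ball around x is covered by two
    disjoint open sets V and W, both accumulating at x.  For small r the function u
    equal to min(1, d(x,.)/r) on V and to 0 elsewhere has, on a fixed ball B around x,
    an upper gradient equal to 1/r on B_r(x) and to 0 off it, because a path from V to
    W inside B runs through x.  (Outside B the gradient is put to +oo, so that paths
    leaving B impose no condition.)  As r decreases the mean oscillation of u on B
    stays bounded below, since u is 1 on a fixed ball in V and 0 on a fixed ball in W,
    whereas the gradient side of the Poincare inequality is a fixed multiple of
    (mu(B_r(x)) / r^p)^(1/p), whose lower limit is 0. *)

(** * Metric topology and paths of speed at most one *)

Section paths.
Local Set Implicit Arguments.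
Local Unset Strict Implicit.
Local Unset Printing Implicit Defensive.
Context {R : realType} {X : Type} (dist : X -> X -> R).
Hypothesis dist_metric : is_metric dist.

Let dist_ge0 x y : 0 <= dist x y. Proof. exact: dist_metric.1. Qed.
Let dist_refl x : dist x x = 0. Proof. by apply/dist_metric.2.1. Qed.
Let distC x y : dist x y = dist y x. Proof. exact: dist_metric.2.2.1. Qed.
Let dist_triangle y x z : dist x z <= dist x y + dist y z.
Proof. exact: dist_metric.2.2.2. Qed.

Lemma dist_gt0 x y : x <> y -> 0 < dist x y.
Proof.
move=> xy; rewrite lt_neqAle dist_ge0 andbT eq_sym.
by apply/eqP => /dist_metric.2.1.
Qed.

Lemma dopen_dist_lt x r : dopen dist [set y | dist x y < r].
Proof.
move=> y /= yr; exists (r - dist x y); first by rewrite subr_gt0.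
by move=> z; rewrite /oball /=; have := dist_triangle y x z; lra.
Qed.

Lemma dopen_dist_gt x r : dopen dist [set y | r < dist x y].
Proof.
move=> y /= yr; exists (dist x y - r); first by rewrite subr_gt0.
by move=> z; rewrite /oball /=; have := dist_triangle z x y; rewrite (distC z y); lra.
Qed.

Lemma dopenI U V : dopen dist U -> dopen dist V -> dopen dist (U `&` V).
Proof.
move=> oU oV y [/oU[r r0 rU] /oV[s s0 sV]].
exists (Num.min r s); first by rewrite lt_min r0.
by move=> z; rewrite /oball /= lt_min => /andP[/rU ? /sV ?].
Qed.

Lemma dopenU U V : dopen dist U -> dopen dist V -> dopen dist (U `|` V).
Proof.
move=> oU oV y [/oU|/oV] [r r0 rS]; exists r => // z /rS; by [left|right].
Qed.

Lemma dopen_setD1 U x : dopen dist U -> dopen dist (U `\ x).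
Proof.
move=> oU; suff -> : U `\ x = U `&` [set y | 0 < dist x y].
  exact/dopenI/dopen_dist_gt.
apply/seteqP; split => y [Uy] /= xy; split => //.
  by apply: dist_gt0 => /esym.
by move=> yx; rewrite yx dist_refl ltxx in xy.
Qed.

(** What the argument keeps of an arclength parametrization: unlike the variation, this bound passes
    at once to subintervals and to reversed paths. *)
Definition lipschitz_path (gamma : R -> X) (a b : R) : Prop :=
  forall s t, a <= s -> s <= t -> t <= b -> dist (gamma s) (gamma t) <= t - s.

Lemma arclength_path_lipschitz gamma l :
  arclength_path dist gamma l -> lipschitz_path gamma 0 l.
Proof.
move=> [_ len] s t s0 st tl; rewrite -lee_fin -(len s t)//.
apply: ereal_sup_ubound; exists 1%N, (fun i => if i == 0%N then s else t).
by split => //; [case|rewrite big_ord1].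
Qed.

Lemma lipschitz_pathS gamma a b a' b' : a <= a' -> b' <= b ->
  lipschitz_path gamma a b -> lipschitz_path gamma a' b'.
Proof. by move=> aa bb lip s t ? ? ?; apply: lip => //; lra. Qed.

Lemma lipschitz_path_rev gamma l :
  lipschitz_path gamma 0 l -> lipschitz_path (fun t => gamma (l - t)) 0 l.
Proof.
move=> lip s t s0 st tl; rewrite distC (_ : t - s = (l - s) - (l - t)); last by lra.
by apply: lip; lra.
Qed.

Lemma lipschitz_path_dopen gamma a b (U : set X) t : lipschitz_path gamma a b ->
  dopen dist U -> a <= t <= b -> U (gamma t) ->
  exists2 e : R, 0 < e & forall s, a <= s <= b -> `|s - t| < e -> U (gamma s).
Proof.
move=> lip oU atb /oU[e e0 eU]; exists e => // s asb ste; apply: eU.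
rewrite /oball /=; have [st|ts] := leP s t.
  rewrite distC; apply: le_lt_trans (lip _ _ _ st _) _; try lra.
  by move: ste; rewrite ler0_norm; lra.
apply: le_lt_trans (lip _ _ _ (ltW ts) _) _; try lra.
by move: ste; rewrite gtr0_norm; lra.
Qed.

(** The infimum of the times spent outside U is itself such a time: were the path in the open set U
    there, it would stay in U for a while, and no time outside U could come close to the infimum
    from above. *)
Lemma first_exit_time gamma a b (U : set X) : lipschitz_path gamma a b ->
  dopen dist U -> a <= b -> ~ U (gamma b) ->
  exists t, [/\ a <= t, t <= b, ~ U (gamma t) &
    forall s, a <= s -> s < t -> U (gamma s)].
Proof.
move=> lip oU ab nUb.
pose E := [set t | a <= t <= b /\ ~ U (gamma t)].
have Eb : E b by rewrite /E /= lexx ab.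
have hE : has_inf E by split; [exists b|exists a => t [/andP[]]].
have aE : a <= inf E by apply: lb_le_inf; [exists b|move=> t [/andP[]]].
have Eb' : inf E <= b by apply: ge_inf => //; exact: hE.2.
exists (inf E); split => //.
  move=> UE; have [|e e0 eU] := lipschitz_path_dopen lip oU _ UE; first by rewrite aE.
  have [s [asb nUs] se] := inf_adherent e0 hE.
  apply/nUs/eU => //; have : inf E <= s by apply: ge_inf => //; exact: hE.2.
  by move=> Es; rewrite ger0_norm; lra.
move=> s sa sE; apply: contrapT => nUs.
have : inf E <= s by apply: ge_inf; [exact: hE.2|split => //; apply/andP; split => //; lra].
by rewrite leNgt sE.
Qed.

(* The interval ends at the first exit from the ball, or at b if there is none. *)
Lemma truncated_dist_path gamma a b x r : lipschitz_path gamma a b -> a <= b ->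
  exists s t, [/\ a <= s, s <= t, t <= b,
    (forall u, s < u -> u < t -> dist x (gamma u) < r) &
    Num.min r (dist x (gamma b)) - Num.min r (dist x (gamma a)) <= t - s].
Proof.
move=> lip ab.
have increase t : a <= t -> t <= b -> dist x (gamma t) <= dist x (gamma a) + (t - a).
  move=> at_ tb; apply: le_trans (dist_triangle (gamma a) _ _) _.
  by rewrite lerD2l; exact: lip.
have [[v [/andP[av vb] rv]]|in_ball] :=
    pselect (exists v, a <= v <= b /\ r <= dist x (gamma v)); last first.
  have ball u : a <= u -> u <= b -> dist x (gamma u) < r.
    move=> au ub; rewrite ltNge; apply/negP => ru; apply: in_ball.
    by exists u; rewrite au ub.
  exists a, b; split => //; first by move=> u au ub; apply: ball; exact: ltW.
  by rewrite !min_r ?(ltW (ball _ _ _))//; have := increase b; lra.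
have [t [at_ tv /negP rt tmin]] : exists t, [/\ a <= t, t <= v,
    ~ oball dist x r (gamma t) & forall s, a <= s -> s < t -> oball dist x r (gamma s)].
  apply: first_exit_time => //; first exact: lipschitz_pathS lip.
    exact: dopen_dist_lt.
  by apply/negP; rewrite -leNgt.
rewrite -leNgt in rt; exists a, t; split => //; first exact: le_trans vb.
  by move=> u au ut; apply: tmin => //; exact: ltW.
(* At t the distance is at least r, so r - d(x, gamma a) <= t - a. If the path starts outside the
   ball, the truncated distance does not increase at all. *)
have := increase t at_ (le_trans tv vb).
have : Num.min r (dist x (gamma b)) <= r by rewrite ge_min lexx.
by case: (leP r (dist x (gamma a))); lra.
Qed.

(** * The cutoff function and its variation along paths *)

Section cutoff.
Variables (x : X) (V W : set X) (rho r : R).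
Hypotheses (oV : dopen dist V) (oW : dopen dist W) (r0 : 0 < r).
Hypothesis cover : forall y, dist x y <= rho -> y <> x -> V y \/ W y.
Hypothesis disj : forall y, dist x y <= rho -> V y -> ~ W y.

Definition cutoff (y : X) : R :=
  if `[< V y >] then Num.min 1 (dist x y / r) else 0.

Lemma cutoff_ge0 y : 0 <= cutoff y.
Proof. by rewrite /cutoff; case: ifP => // _; rewrite le_min ler01 divr_ge0// ltW. Qed.

Lemma cutoff_le1 y : cutoff y <= 1.
Proof. by rewrite /cutoff; case: ifP => // _; rewrite ge_min lexx. Qed.

Let cutoffE y : V y -> cutoff y = Num.min r (dist x y) / r.
Proof.
move=> Vy; rewrite /cutoff asboolT// minr_pMl ?invr_ge0 ?ltW//.
by rewrite divff// gt_eqF.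
Qed.

(* A path entering V from outside has to go through x, where the truncated distance is 0. *)
Lemma cutoff_path gamma l : lipschitz_path gamma 0 l -> 0 <= l ->
  (forall t, 0 <= t <= l -> dist x (gamma t) <= rho) ->
  exists s t, [/\ 0 <= s, s <= t, t <= l,
    (forall u, s < u -> u < t -> dist x (gamma u) < r) &
    `|cutoff (gamma l) - cutoff (gamma 0)| <= (t - s) / r].
Proof.
(* Reversing the path swaps the end values, so the cutoff may be assumed not to decrease from start
   to end. *)
move: gamma; suff wlog_le gamma : lipschitz_path gamma 0 l -> 0 <= l ->
    (forall t, 0 <= t <= l -> dist x (gamma t) <= rho) ->
    cutoff (gamma 0) <= cutoff (gamma l) ->
    exists s t, [/\ 0 <= s, s <= t, t <= l,
      (forall u, s < u -> u < t -> dist x (gamma u) < r) &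
      cutoff (gamma l) - cutoff (gamma 0) <= (t - s) / r].
  move=> gamma lip l0 inball.
  have [le|/ltW le] := leP (cutoff (gamma 0)) (cutoff (gamma l)).
    have [s [t [? ? ? ? ?]]] := wlog_le _ lip l0 inball le.
    by exists s, t; split => //; rewrite ger0_norm// subr_ge0.
  have := wlog_le _ (lipschitz_path_rev lip) l0.
  rewrite subrr subr0 => -[|//|s [t [? ? ? bt ?]]].
    by move=> t tl; apply: inball; lra.
  exists (l - t), (l - s); split; try lra.
    by move=> u ? ?; rewrite -(subKr l u); apply: bt; lra.
  by rewrite ler0_norm ?subr_le0// opprB (_ : l - s - (l - t) = t - s)//; lra.
move=> lip l0 inball le.
(* Off V the final value is 0, so there is no increase and a degenerate interval suffices. *)
have [Vl|nVl] := pselect (V (gamma l)); last first.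
  exists 0, 0; split => //; first by move=> u ? ?; lra.
  rewrite subrr mul0r {1}/cutoff asboolF// sub0r oppr_le0; exact: cutoff_ge0.
(* It is enough to follow the path from a time a at which the truncated distance is no larger than r
   times the initial cutoff. This time is 0 if the path starts in V, and a passage time through x
   otherwise. *)
have estimate a : 0 <= a -> a <= l -> Num.min r (dist x (gamma a)) / r <= cutoff (gamma 0) ->
  exists s t, [/\ 0 <= s, s <= t, t <= l,
    (forall u, s < u -> u < t -> dist x (gamma u) < r) &
    cutoff (gamma l) - cutoff (gamma 0) <= (t - s) / r].
  move=> a0 al ua; have [||s [t [as_ st tl bt le_ts]]] := @truncated_dist_path gamma a l x r.
  - exact: lipschitz_pathS lip.
  - by [].
  exists s, t; split => //; first exact: le_trans as_.
  apply: le_trans (_ : (Num.min r (dist x (gamma l)) - Num.min r (dist x (gamma a))) / r <= _).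
    by rewrite mulrBl (cutoffE Vl) lerB.
  by rewrite ler_pM2r ?invr_gt0.
have [V0|nV0] := pselect (V (gamma 0)).
  by apply: (@estimate 0) => //; rewrite cutoffE.
have : exists2 t, 0 <= t <= l & gamma t = x.
  have [<-|g0x] := pselect (gamma 0 = x); first by exists 0; rewrite ?lexx.
  have W0 : W (gamma 0) by case: (cover (inball 0 _) g0x); rewrite ?lexx.
  (* At its first exit from W the path is at x or in V. In the latter case, V being open, it is
     already in V slightly earlier, while still in W, against disjointness. *)
  have [|t [t0 tl nWt Wt]] := first_exit_time lip oW l0.
    by apply: disj => //; apply: inball; rewrite l0 lexx.
  have tl' : 0 <= t <= l by rewrite t0.
  exists t => //; apply: contrapT => tx.
  have Vt : V (gamma t) by case: (cover (inball t tl') tx).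
  have [e e0 eV] := lipschitz_path_dopen lip oV tl' Vt.
  have t_gt0 : 0 < t by rewrite lt_neqAle t0 andbT; apply/eqP => t00; apply: nV0; rewrite t00.
  pose s := Num.max 0 (t - e / 2).
  have st : s < t by rewrite gt_max t_gt0; lra.
  have s0 : 0 <= s by rewrite le_max lexx.
  have se : t - e / 2 <= s by rewrite le_max lexx orbT.
  have sl : 0 <= s <= l by rewrite s0; lra.
  apply: (disj (inball s sl)); last exact: Wt.
  by apply: eV => //; rewrite ltr0_norm; lra.
case=> t /andP[t0 tl] tx; apply: (@estimate t) => //.
by rewrite tx dist_refl min_r ?mul0r ?cutoff_ge0// ltW.
Qed.

End cutoff.
End paths.

(** * Lower bounds for integrals *)

Section lower_bounds.
Local Set Implicit Arguments.
Local Unset Strict Implicit.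
Import HBNNSimple.

(* Whether or not f is measurable, its integral is the supremum of the integrals of
   the simple functions below f, and c * 1_A is one of them. *)
Lemma le_measure_integral d (T : measurableType d) (R : realType)
    (mu : {measure set T -> \bar R}) (A D : set T) (f : T -> \bar R) (c : R) :
  measurable A -> A `<=` D -> 0 <= c -> (forall x, D x -> (0 <= f x)%E) ->
  (forall x, A x -> (c%:E <= f x)%E) ->
  (c%:E * mu A <= \int[mu]_(x in D) f x)%E.
Proof.
move=> mA AD c0 f0 cf; rewrite ge0_integralE// -integral_cst//.
rewrite ge0_integralE; last by move=> x _; rewrite lee_fin.
apply: ge_ereal_sup => _ [h hA <-]; apply: ereal_sup_ubound; exists h => // x.
apply: le_trans (hA x) _; rewrite /patch; case: ifPn => [/set_mem Ax|_].
  by rewrite mem_set; [exact: cf|exact: AD].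
by case: ifPn => // /set_mem; exact: f0.
Qed.

(** The interval is open because a path is controlled only strictly between two times. For t <= s
    the left side is nonpositive. *)
Lemma le_itv_integral (R : realType) (f : R -> \bar R) (D : set R) (c s t : R) :
  `]s, t[%classic `<=` D -> 0 <= c -> (forall x, D x -> (0 <= f x)%E) ->
  (forall x, s < x -> x < t -> (c%:E <= f x)%E) ->
  ((c * (t - s))%:E <= \int[lebesgue_measure]_(x in D) f x)%E.
Proof.
move=> stD c0 f0 cf; have [st|ts] := ltP s t; last first.
  rewrite (@le_trans _ _ 0%E) ?integral_ge0// lee_fin.
  by rewrite mulr_ge0_le0// subr_le0.
have -> : ((c * (t - s))%:E = c%:E * lebesgue_measure (`]s, t[%classic : set R))%E.
  by rewrite lebesgue_measure_itv /= lte_fin st.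
apply: le_measure_integral => // x; rewrite /= in_itv /= => /andP[]; exact: cf.
Qed.

End lower_bounds.

(** * The upper gradient of the cutoff *)

Section gradient.
Local Set Implicit Arguments.
Local Unset Strict Implicit.
Context {R : realType} {d : measure_display} {X : measurableType d}
  (dist : X -> X -> R).
Variables (x : X) (rho r : R).

Definition cutoff_gradient (y : X) : \bar R :=
  if dist x y < r then (r^-1)%:E else if dist x y <= rho then 0%E else +oo%E.

Hypothesis r0 : 0 < r.

Lemma cutoff_gradient_ge0 y : (0 <= cutoff_gradient y)%E.
Proof.
by rewrite /cutoff_gradient; do 2?[case: ifP => // _]; rewrite lee_fin invr_ge0 ltW.
Qed.

Hypotheses (dist_metric : is_metric dist) (r_rho : r <= rho).

(* A path leaving the closed ball of radius rho does so for a positive time. *)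
Lemma integral_cutoff_gradient_exit gamma l v : lipschitz_path dist gamma 0 l ->
  0 < l -> 0 <= v <= l -> rho < dist x (gamma v) ->
  (\int[lebesgue_measure]_(t in `[0%R, l]) cutoff_gradient (gamma t) = +oo)%E.
Proof.
move=> lip l0 vl xv.
have [e e0 eU] := lipschitz_path_dopen dist_metric lip
  (@dopen_dist_gt _ _ _ dist_metric x rho) vl xv.
have [s [t [s0 st tl out]]] : exists s t, [/\ 0 <= s, s < t, t <= l &
    forall u, s < u -> u < t -> rho < dist x (gamma u)].
  have [v0|v0] := ltP 0 v.
    exists (Num.max 0 (v - e)), v; split; first by rewrite le_max lexx.
    - by rewrite gt_max v0; lra.
    - by case/andP: vl.
    move=> u; rewrite gt_max => /andP[? ?] ?; apply: eU; first lra.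
    by rewrite ltr0_norm; lra.
  exists 0, (Num.min l e); split; rewrite ?lt_min ?l0 ?ge_min ?lexx//.
  move=> u ?; rewrite lt_min => /andP[? ?]; apply: eU; first lra.
  by rewrite ger0_norm; lra.
(* The integrand is +oo on ]s, t[, hence at least M / (t - s) there for every M. *)
apply/eqyP => M M0.
rewrite (_ : M = M / (t - s) * (t - s)); last by rewrite divfK// subr_eq0 gt_eqF.
apply: le_itv_integral.
- by move=> u; rewrite /= !in_itv /=; lra.
- by rewrite divr_ge0 ?ltW// subr_gt0.
- by move=> u _; exact: cutoff_gradient_ge0.
move=> u su ut; rewrite /cutoff_gradient; move: (out u su ut).
move=> out_u; rewrite [dist _ _ <= rho]leNgt out_u /=.
by rewrite ltNge (le_trans r_rho (ltW out_u)) leey.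
Qed.

(** A path leaving the closed ball has infinite integral. For any other path, [cutoff_path] provides
    an interval on which the gradient is 1/r and whose length divided by r bounds the increment. *)
Lemma cutoff_upper_gradient (V W : set X) : dopen dist V -> dopen dist W ->
  (forall y, dist x y <= rho -> y <> x -> V y \/ W y) ->
  (forall y, dist x y <= rho -> V y -> ~ W y) ->
  upper_gradient dist (cutoff dist x V r) cutoff_gradient.
Proof.
move=> oV oW cover disj gamma l arc.
have lip := arclength_path_lipschitz arc; have [l0 _] := arc.
have [l_eq0|l_neq0] := eqVneq l 0.
  rewrite l_eq0 subrr normr0; apply: integral_ge0 => t _.
  exact: cutoff_gradient_ge0.
have l_gt0 : 0 < l by rewrite lt_neqAle eq_sym l_neq0.
have [[v [vl xv]]|inball] := pselect (exists v, 0 <= v <= l /\ rho < dist x (gamma v)).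
  by rewrite (integral_cutoff_gradient_exit lip l_gt0 vl xv) leey.
have [|s [t [s0 st tl bt le_ts]]] :=
    cutoff_path dist_metric oV oW r0 cover disj lip l0.
  by move=> t tl; rewrite leNgt; apply/negP => xt; apply: inball; exists t.
apply: le_trans (_ : ((r^-1 * (t - s))%:E <= _)%E); first by rewrite lee_fin mulrC.
apply: le_itv_integral.
- by move=> u; rewrite /= !in_itv /=; lra.
- by rewrite invr_ge0 ltW.
- by move=> u _; exact: cutoff_gradient_ge0.
by move=> u su ut; rewrite /cutoff_gradient bt.
Qed.

End gradient.

(** * Splitting a punctured ball, and small radii from the lower limit *)

Lemma local_cut_point_split (R : realType) (X : Type) (dist : X -> X -> R) (x : X) :
  is_metric dist -> local_cut_point dist x ->
  exists rho (V W : set X), [/\ 0 < rho, dopen dist V, dopen dist W & ~ V x] /\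
    [/\ forall y, dist x y <= rho -> y <> x -> V y \/ W y,
        forall y, dist x y <= rho -> V y -> ~ W y,
        V `&` oball dist x rho !=set0 & W `&` oball dist x rho !=set0].
Proof.
move=> dist_metric [U [[R0 R00 R0U] [Uconn nconn]]].
have [V [W [[oV oW cover UV UW] disj]]] : exists V W, [/\ dopen dist V, dopen dist W,
    U `\ x `<=` V `|` W, (U `\ x) `&` V !=set0 & (U `\ x) `&` W !=set0] /\
    ~ ((U `\ x) `&` V `&` W !=set0).
  apply: contrapT => none; apply: nconn => V W oV oW cover UV UW.
  by apply: contrapT => disj; apply: none; exists V, W.
have Ux : U x by apply: R0U; rewrite /oball /= (dist_metric.2.1 _ _).2.
(* Enlarging B by the ball yields an open cover of all of U, x included. Connectedness of U then
   gives a point of A other than x lying in B or in the ball, and disjointness rules out B. *)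
have meets_ball (A B : set X) : dopen dist A -> dopen dist B ->
    U `\ x `<=` A `|` B -> (U `\ x) `&` A !=set0 ->
    ~ ((U `\ x) `&` A `&` B !=set0) -> (A `\ x) `&` oball dist x (R0 / 2) !=set0.
  move=> oA oB cov [a [[Ua ax] Aa]] dis.
  have [|||||y [[Uy [Ay yx]] [By|xy]]] := Uconn (A `\ x) (B `|` oball dist x (R0 / 2)).
  - exact: dopen_setD1.
  - exact/dopenU/dopen_dist_lt.
  - move=> y Uy; have [->|yx] := pselect (y = x).
      by right; right; rewrite /oball /= (dist_metric.2.1 _ _).2// divr_gt0.
    by have [|Ay|By] := cov y; [|left|right; left].
  - by exists a.
  - exists x; split => //; right.
    by rewrite /oball /= (dist_metric.2.1 _ _).2// divr_gt0.
  - by case: dis; exists y.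
  - by exists y.
have half y : dist x y <= R0 / 2 -> U y by move=> xy; apply: R0U; rewrite /oball /=; lra.
(* Halving the radius puts the closed ball inside U. V and W may contain x, so x is removed from
   both. *)
exists (R0 / 2), (V `\ x), (W `\ x); split; split.
- by rewrite divr_gt0.
- exact: dopen_setD1.
- exact: dopen_setD1.
- by move=> [_]; apply.
- move=> y /half Uy yx; by have [|Vy|Wy] := cover y; [|left|right].
- by move=> y /half Uy [Vy yx] [Wy _]; apply: disj; exists y.
- exact: (meets_ball V W).
- apply: (meets_ball W V) => //; first by rewrite setUC.
  by rewrite -setIA (setIC W) setIA.
Qed.

(** The lower limit is a supremum of infima over right neighbourhoods of 0, so the infimum over ]0,
    delta[ is at most 0, hence below e. *)
Lemma limf_einf_right0_lt (R : realType) (f : R -> R) (delta e : R) :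
  limf_einf (fun r => (f r)%:E) 0^'+ = 0%E -> 0 < delta -> 0 < e ->
  exists r, [/\ 0 < r, r < delta & f r < e].
Proof.
rewrite limf_einfE => lim0 d0 e0.
have : (ereal_inf ((fun r => (f r)%:E) @` [set r | 0 < r < delta]%R) < e%:E)%E.
  apply: le_lt_trans (_ : (0 < e%:E)%E); last by rewrite lte_fin.
  rewrite -lim0; apply: ereal_sup_ubound; exists [set r | 0 < r < delta]%R => //.
  near=> r; apply/andP; split; near: r; first exact: nbhs_right_gt.
  exact: nbhs_right_lt.
by move=> /ereal_inf_lt[_ [r /andP[r0 rd] <-]]; rewrite lte_fin => fr; exists r.
Unshelve. all: by end_near.
Qed.

(** * Measurability of the distance and of the cutoff *)

Section measurable_distance.
Local Set Implicit Arguments.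
Local Unset Strict Implicit.
Context {R : realType} {d : measure_display} {X : measurableType d}.
Variable dist : X -> X -> R.
Hypotheses (dist_metric : is_metric dist)
  (dopen_measurable : forall U : set X, dopen dist U -> measurable U).

Lemma measurable_dist x : measurable_fun setT (dist x).
Proof.
apply: (measurability _ (RGenInftyO.measurableE R)) => //.
move=> _ [_ [a ->] <-]; rewrite setTI; apply: dopen_measurable.
rewrite (_ : _ @^-1` _ = [set y | dist x y < a]); first exact: dopen_dist_lt.
by apply/seteqP; split => y; rewrite /= in_itv.
Qed.

Lemma measurable_cutoff x V r : dopen dist V -> measurable_fun setT (cutoff dist x V r).
Proof.
move=> oV; apply: measurable_fun_ifT => //.
  apply: (measurable_fun_bool true); rewrite setTI.
  rewrite (_ : _ @^-1` _ = V); first exact: dopen_measurable.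
  by apply/seteqP; split => y /= /asboolP.
apply: measurable_minr => //; apply: measurable_funM => //.
exact: measurable_dist.
Qed.

End measurable_distance.

(** * The two sides of the Poincaré inequality for the cutoff *)

Section cutoff_poincare.
Local Set Implicit Arguments.
Local Unset Strict Implicit.
Context {R : realType} {d : measure_display} {X : measurableType d}.
Variables (dist : X -> X -> R) (mu : {measure set X -> \bar R}).
Hypotheses (dist_metric : is_metric dist)
  (dopen_measurable : forall U : set X, dopen dist U -> measurable U).

Lemma measurable_cutoff_gradient x rho r :
  measurable_fun setT (cutoff_gradient dist x rho r).
Proof.
apply: measurable_fun_ifT => //.
  by apply: measurable_fun_ltr => //; exact: measurable_dist.
apply: measurable_fun_ifT => //.
by apply: measurable_fun_ler => //; exact: measurable_dist.
Qed.

Lemma integral_cutoff_gradient x rho r p : 0 < r -> r <= rho -> p != 0 ->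
  (\int[mu]_(y in oball dist x rho) (cutoff_gradient dist x rho r y `^ p)
   = ((r `^ p)^-1)%:E * mu (oball dist x r))%E.
Proof.
move=> r0 r_rho p0.
have mB s : measurable (oball dist x s) by apply/dopen_measurable/dopen_dist_lt.
have sub : oball dist x r `<=` oball dist x rho.
  by move=> y; rewrite /oball /= => /lt_le_trans; apply.
transitivity (\int[mu]_(y in oball dist x rho)
    (((r `^ p)^-1)%:E * (\1_(oball dist x r) y)%:E))%E.
  apply: eq_integral => y /set_mem; rewrite /oball /= => y_rho.
  rewrite /cutoff_gradient indicE; case: ifPn => [|/negP] yr.
    by rewrite mem_set// mule1 /= -powR_inv1 ?ltW// -powRrM mulN1r powRN.
  (* Here the gradient is 0, and [p != 0] matters because 0 to the power 0 is 1. *)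
  by rewrite memNset ?mule0 ?(ltW y_rho) /= ?powR0.
rewrite ge0_integralZl_EFin//; last 2 first.
- by apply/measurable_EFinP; exact: measurable_indic.
- by rewrite invr_ge0 powR_ge0.
by rewrite integral_indic// (_ : _ `&` _ = oball dist x r)//; exact/setIidl.
Qed.

(* The number a cannot be within 1/2 of both 0 and 1. *)
Lemma integral_oscillation_ge (B D E : set X) (u : X -> R) (a k : R) :
  measurable D -> measurable E -> D `<=` B -> E `<=` B ->
  (forall y, D y -> u y = 1) -> (forall y, E y -> u y = 0) ->
  (k%:E <= mu D)%E -> (k%:E <= mu E)%E ->
  ((2^-1 * k)%:E <= \int[mu]_(y in B) (`|u y - a|)%:E)%E.
Proof.
move=> mD mE DB EB u1 u0 kD kE.
have half A : measurable A -> A `<=` B -> (k%:E <= mu A)%E ->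
    (forall y, A y -> 2^-1 <= `|u y - a|) ->
    ((2^-1 * k)%:E <= \int[mu]_(y in B) (`|u y - a|)%:E)%E.
  move=> mA AB kA uA; apply: le_trans (_ : (2^-1%:E * mu A <= _)%E).
    by rewrite EFinM; apply: lee_wpmul2l => //; rewrite lee_fin invr_ge0.
  apply: le_measure_integral => //.
have [a2|a2] := ltP a 2^-1; [apply: (half D) => // y Dy|apply: (half E) => // y Ey].
  by rewrite u1// ger0_norm; lra.
by rewrite u0// sub0r normrN ger0_norm; lra.
Qed.

End cutoff_poincare.

(** * Contradiction with the Poincaré inequality at a small radius *)

Theorem theorem1p3 (R : realType) (d : measure_display) (X : measurableType d)
  (dist : X -> X -> R)
  (Hmetric : is_metric dist)
  (Hborel : forall A : set X, measurable A <-> <<s [set U | dopen dist U] >> A)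
  (Hcomplete : dcomplete dist)
  (Hlocc : dlocally_compact dist)
  (Hlength : dlength_space dist)
  (mu : {measure set X -> \bar R})
  (Hball : forall (x : X) (r : R), 0 < r ->
     (0 < mu (oball dist x r))%E /\ (mu (oball dist x r) < +oo)%E)
  (p : R) (hp : 1 <= p)
  (HPI : poincare_1p dist mu p)
  (x : X)
  (hx : limf_einf (fun r : R => (fine (mu (oball dist x r)) / r `^ p)%:E) 0^'+ = 0%E) :
  ~ local_cut_point dist x.
Proof.
case/(local_cut_point_split _ _ _ _ Hmetric) => rho [V [W [[rho0 oV oW Vx]]]].
case=> cover disj [v [Vv xv]] [w [Ww xw]].
have dopen_measurable (U : set X) : dopen dist U -> measurable U.
  by move=> oU; apply/Hborel; exact: sub_sigma_algebra.
have mB y s : measurable (oball dist y s) by apply/dopen_measurable/dopen_dist_lt.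
have muB y s : 0 < s -> mu (oball dist y s) = (fine (mu (oball dist y s)))%:E.
  move=> s0; rewrite fineK// ge0_fin_numE//; exact: (Hball y s s0).2.
have muB_gt0 y s : 0 < s -> 0 < fine (mu (oball dist y s)).
  by move=> s0; rewrite -lte_fin -muB//; exact: (Hball y s s0).1.
have p0 : 0 < p by apply: lt_le_trans hp.
have xv0 : 0 < dist x v by apply: dist_gt0 => // xv'; apply: Vx; rewrite xv'.
(* Staying farther than d(x, v) / 2 from x makes the cutoff equal to 1 on the whole ball around v as
   soon as r is below that number. *)
have [a a0 aV] : exists2 a, 0 < a & oball dist v a `<=`
    V `&` oball dist x rho `&` [set y | dist x v / 2 < dist x y].
  have oVx : dopen dist (V `&` oball dist x rho `&` [set y | dist x v / 2 < dist x y]).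
    by apply: dopenI; [apply: dopenI => //; exact: dopen_dist_lt|exact: dopen_dist_gt].
  by apply: oVx; split => //=; lra.
have [b b0 bW] : exists2 b, 0 < b & oball dist w b `<=` W `&` oball dist x rho.
  have oWx : dopen dist (W `&` oball dist x rho).
    by apply: dopenI => //; exact: dopen_dist_lt.
  exact: oWx.
have [C C0 PI] := HPI rho rho0.
set B := oball dist x rho in aV bW.
pose m := fine (mu B); have m0 : 0 < m by exact: muB_gt0.
pose k := Num.min (fine (mu (oball dist v a))) (fine (mu (oball dist w b))).
have k0 : 0 < k by rewrite lt_min !muB_gt0.
(* With this e, C * rho * e is exactly the lower bound m^-1 * (k / 2) for the mean oscillation.
   Neither k nor e depends on r, so r can be chosen afterwards with mu(B_r(x)) / r^p < m * e^p. *)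
pose e := m^-1 * (2^-1 * k) / (C * rho).
have e0 : 0 < e by rewrite !(mulr_gt0, divr_gt0, invr_gt0).
have [||r [r0]] := limf_einf_right0_lt _ _ (Num.min rho (dist x v / 2)) (m * e `^ p) hx.
- by rewrite lt_min rho0 divr_gt0.
- by rewrite mulr_gt0// powR_gt0.
rewrite lt_min => /andP[r_rho r_v] small.
have u01 y : 0 <= cutoff dist x V r y <= 1 by rewrite cutoff_ge0//= cutoff_le1.
have mcut : measurable_fun setT (cutoff dist x V r) by exact: measurable_cutoff.
have icut : mu.-integrable B (EFin \o cutoff dist x V r).
  apply: measurable_bounded_integrable.
  - exact: mB.
  - exact: (Hball x rho rho0).2.
  - exact: measurable_funTS.
  exists 1; split; first exact: num_real.
  move=> M M1 y _ /=; have /andP[u0 u1] := u01 y; rewrite ger0_norm//.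
  exact: le_trans (ltW M1).
have := PI x rho rho0 (lexx _) _ _ mcut icut
  (measurable_cutoff_gradient Hmetric dopen_measurable x rho r)
  (cutoff_gradient_ge0 dist x rho r0)
  (cutoff_upper_gradient r0 Hmetric (ltW r_rho) oV oW cover disj).
(* The oscillation bound holds around any number, so the mean value is generalized to an arbitrary
   [uB]. *)
cbv zeta; rewrite -/B -/m; move: (m^-1 * _)%R => uB.
rewrite integral_cutoff_gradient ?(ltW r_rho) ?gt_eqF//.
rewrite muB// -!EFinM; apply/negP; rewrite -ltNge.
have osc : ((2^-1 * k)%:E <= \int[mu]_(y in B) (`|cutoff dist x V r y - uB|)%:E)%E.
  apply: (integral_oscillation_ge (D := oball dist v a) (E := oball dist w b)) => //.
  - by move=> y /aV[[]].
  - by move=> y /bW[].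
  - move=> y /aV[[Vy _] /= vy]; rewrite /cutoff asboolT// min_l// ler_pdivlMr// mul1r.
    by rewrite ltW// (lt_trans r_v).
  - move=> y /bW[Wy yB]; rewrite /cutoff asboolF// => Vy.
    exact: (disj y (ltW yB) Vy Wy).
  - by rewrite muB// lee_fin ge_min lexx.
  - by rewrite muB// lee_fin ge_min lexx orbT.
apply: lt_le_trans (lee_wpmul2l _ osc); last by rewrite lee_fin invr_ge0 ltW.
rewrite -EFinM lte_fin mulrC -ltr_pdivlMr ?mulr_gt0// -/e.
(* Once e is written as a p-th root, strict monotonicity of the power 1/p reduces the claim to the
   choice of r. *)
have eE : e = (e `^ p) `^ p^-1 by rewrite -powRrM divff ?gt_eqF// powRr1 ?ltW.
rewrite eE gt0_ltr_powR ?invr_gt0 ?nnegrE ?powR_ge0//.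
  by rewrite !mulr_ge0 ?invr_ge0 ?powR_ge0 ?ltW ?muB_gt0.
by rewrite ltr_pdivrMl// mulrC.
Qed.
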